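(* There exists an infinite graph property $\Pi$ of $d$-bounded graphs such that: (i) $\Pi$ is testable (with two-sided error) with query complexity $O(d/\varepsilon^2)$; (ii) $\Pi$ is not hyperfinite; (iii) every $n$-vertex graph in $\Pi$ differs in $\Omega(n)$ edges from every connected $n$-vertex graph.
   Context: A graph is $d$-bounded if its maximum degree is at most $d$. A graph property is a set of graphs closed under isomorphism; $\Pi_n$ is the set of its $n$-vertex members. An $n$-vertex $d$-bounded graph is $\varepsilon$-far from $\Pi_n$ if more than $\varepsilon dn$ edge modifications are needed to obtain a graph in $\Pi_n$. A tester gets $\varepsilon$, $n$, $d$ and adjacency-list query access (query $(u,i)$ returns the $i$-th neighbor of $u$ or a special symbol) to an $n$-vertex $d$-bounded graph, and with probability at least $2/3$ accepts graphs in $\Pi_n$ and rejects graphs $\varepsilon$-far from $\Pi_n$. A graph $G$ is $(\varepsilon,k)$-hyperfinite if removing at most $\varepsilon d|V(G)|$ edges leaves connected components of size at most $k$; a set of graphs is hyperfinite if there is a function $\rho:\mathbb{R}^+\to\mathbb{N}^+$ such that each graph in it is $(\varepsilon,\rho(\varepsilon))$-hyperfinite for all $\varepsilon>0$.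
   Formalization: The degree bound d is taken to be at least 3; for d at most 2 every d-bounded graph is a disjoint union of paths and cycles, so every property of such graphs is hyperfinite and (ii) fails. *)

(* Defs.v *)
From HB Require Import structures.
From mathcomp Require Import all_boot all_order all_algebra.
From mathcomp Require Import boolp classical_sets cardinality reals.

Set Implicit Arguments.
Unset Strict Implicit.
Unset Printing Implicit Defensive.

Import Order.TTheory GRing.Theory Num.Theory.

Local Open Scope ring_scope.

(* Finite simple graphs with vertex set {0, ..., n-1}. *)

Record sgraph (n : nat) := SGraph {
  edges : {set {set 'I_n}};
  edges_card2 : [forall e in edges, #|e| == 2%N]
}.

HB.instance Definition _ n := [isSub for @edges n].
HB.instance Definition _ n := [Finite of sgraph n by <:].

Definition adj n (G : sgraph n) : rel 'I_n :=
  fun u v => [set u; v]%SET \in edges G.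

Definition degree n (G : sgraph n) (u : 'I_n) : nat := #|adj G u|.

Definition bounded (d n : nat) (G : sgraph n) : Prop :=
  forall u, (degree G u <= d)%N.

Definition isomorphic n (G H : sgraph n) : Prop :=
  exists f : 'I_n -> 'I_n,
    bijective f /\ forall u v, adj H (f u) (f v) = adj G u v.

Definition component n (G : sgraph n) (u : 'I_n) : {set 'I_n} :=
  [set v | connect (adj G) u v]%SET.

Definition connected n (G : sgraph n) : Prop :=
  forall u v, connect (adj G) u v.

(* The number of edge insertions and deletions that turn G into H. *)
Definition edit_dist n (G H : sgraph n) : nat :=
  #|(edges G :\: edges H) :|: (edges H :\: edges G)|.

Definition graphs := set {n : nat & sgraph n}.

Definition slice (Pi : graphs) (n : nat) : set (sgraph n) :=
  fun G => Pi (Tagged sgraph G).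

Definition graph_property (Pi : graphs) : Prop :=
  forall n (G H : sgraph n), isomorphic G H -> slice Pi G -> slice Pi H.

(* If no n-vertex graph belongs to Pi, then every n-vertex graph is far. *)
Definition far (R : realType) (d : nat) (Pi : graphs) (eps : R)
    n (G : sgraph n) : Prop :=
  forall H : sgraph n, slice Pi H ->
    eps * d%:R * n%:R < (edit_dist G H)%:R.

Definition hyperfinite_graph (R : realType) (d : nat) (eps : R) (k : nat)
    n (G : sgraph n) : Prop :=
  exists H : sgraph n,
    [/\ edges H \subset edges G,
        #|edges G :\: edges H|%:R <= eps * d%:R * n%:R
      & forall u, (#|component H u| <= k)%N].

Definition hyperfinite (R : realType) (d : nat) (Pi : graphs) : Prop :=
  exists rho : R -> nat, forall eps : R, 0 < eps ->
    (0 < rho eps)%N /\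
    forall n (G : sgraph n), slice Pi G -> hyperfinite_graph d eps (rho eps) G.

(* Randomized algorithms with query access to an n-vertex d-bounded graph:
   [Random m k] draws j uniformly from {0, ..., m} and continues with [k j];
   only [Query] nodes count towards the query complexity. *)

Inductive algo (n d : nat) : Type :=
| Output of bool
| Query (u : 'I_n) (i : 'I_d) of (option 'I_n -> algo n d)
| Random (m : nat) of ('I_m.+1 -> algo n d).

Definition adjlist (n : nat) := 'I_n -> seq 'I_n.

(* The neighbors of a vertex may be listed in any order. *)
Definition represents n (L : adjlist n) (G : sgraph n) : Prop :=
  forall u, uniq (L u) /\ L u =i adj G u.

(* Positions in a list are numbered from 0; the special symbol is None. *)
Definition answer n d (L : adjlist n) (u : 'I_n) (i : 'I_d) : option 'I_n :=
  onth (L u) i.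

Fixpoint prob_output (R : realType) n d (L : adjlist n) (A : algo n d)
    (b : bool) : R :=
  match A with
  | Output b' => (b' == b)%:R
  | Query u i k => prob_output R L (k (answer L u i)) b
  | Random m k => (\sum_(j < m.+1) prob_output R L (k j) b) / m.+1%:R
  end.

(* The maximum over all random choices of the number of queries made. *)
Fixpoint num_queries n d (L : adjlist n) (A : algo n d) : nat :=
  match A with
  | Output _ => 0%N
  | Query u i k => (num_queries L (k (answer L u i))).+1
  | Random m k => (\max_(j < m.+1) num_queries L (k j))%N
  end.

(* Two-sided error testability of Pi on d-bounded graphs with at most q eps
   queries, independently of the number of vertices. *)
Definition testable (R : realType) (d : nat) (Pi : graphs) (q : R -> R) :
    Prop :=
  exists T : R -> forall n, algo n d,
  forall (eps : R) n (G : sgraph n) (L : adjlist n),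
    0 < eps -> bounded d G -> represents L G ->
    [/\ (num_queries L (T eps n))%:R <= q eps,
        slice Pi G -> 2 / 3 <= prob_output R L (T eps n) true
      & far d Pi eps G -> 2 / 3 <= prob_output R L (T eps n) false].

(* Main.v *)
Require Import Defs.
From HB Require Import structures.
From mathcomp Require Import all_boot all_order all_algebra all_fingroup.
From mathcomp Require Import boolp classical_sets cardinality reals.
From mathcomp Require Import zify ring lra.

Set Implicit Arguments.
Unset Strict Implicit.
Unset Printing Implicit Defensive.

Import Order.TTheory GRing.Theory Num.Theory.

Local Open Scope ring_scope.

(* Pi consists of the d-bounded graphs in which at least half of the vertices
   are isolated.  One query decides whether a vertex is isolated, and a graph
   far from Pi has noticeably too few isolated vertices, so estimating their
   proportion from O(1/eps^2) samples is a tester.  A connected graph has an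
   edge at each of the n/2 isolated vertices, whence n/4 insertions.  Finally,
   Pi contains cubic graphs of girth > k padded with isolated vertices: once
   the components have size at most k the graph is a forest, so a constant
   proportion of the edges has been removed.  The cubic graphs are the Cayley
   graphs of the permutation group of the ball of radius k in the 3-regular
   tree, generated by the three involutions that flip the edges of one color. *)

(** * Counting the arcs that survive when components are small *)

(** Normal forms in the free product of copies of Z/2, one copy for each color. *)
Definition reduced (C : eqType) (p : seq C) : bool :=
  sorted (fun a b => a != b) p.

(** Edges are counted as arcs, given by a start and a color; [e] stands for the adjacency left after
    edges are removed. *)
Definition inner_arc (V C : finType) (s : C -> V -> V) (e : rel V)
    (S : {set V}) (v : V) (c : C) : bool :=
  [&& v \in S, s c v \in S & e v (s c v)].

Section FreeInvolutions.

Variables (V C : finType) (s : C -> V -> V) (e : rel V) (A : {set V}) (k : nat).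
Hypothesis s_invol : forall c, involutive (s c).
Hypothesis e_sym : symmetric e.
Hypothesis small : forall u, (#|connect e u| <= k)%N.
Hypothesis free : forall u p, u \in A -> reduced p -> (0 < size p <= k)%N ->
  foldl (fun v c => s c v) u p != u.

Local Notation inner := (inner_arc s e).

(* Otherwise a walk in S can always continue along a color other than the last
   one; by pigeonhole it closes up after at most k steps, against free. *)
Lemma exists_leaf (S : {set V}) :
  S \subset A -> S != finset.set0 ->
  exists2 v, v \in S & (#|[set c | inner S v c]%SET| <= 1)%N.
Proof.
move=> sSA /set0Pn[v0 v0S]; apply/exists_inP; apply: contraT => /exists_inPn deg2.
have nextP v c0 : v \in S -> {c | inner S v c & c0 != c}.
  move=> /deg2; rewrite -ltnNge => lt1; apply: sig2W.
  have /card_gt0P[c] : (0 < #|([set c | inner S v c] :\ c0)%SET|)%N.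
    by have := cardsD1 c0 [set c | inner S v c]%SET; move: lt1; case: (_ \in _); lia.
  by rewrite !inE => /andP[ne gc]; exists c; rewrite // eq_sym.
have [c0 _ _] : exists2 c : C, inner S v0 c & true.
  have /card_gt0P[c] : (0 < #|[set c | inner S v0 c]%SET|)%N.
    by have := deg2 _ v0S; rewrite -ltnNge; apply: ltn_trans.
  by rewrite inE; exists c.
(* The default [c0] is never reached on [S], where [nextP] guarantees a color other than the last
   one. *)
pose next v c := odflt c0 [pick c' | inner S v c' && (c != c')].
have nextS v c : v \in S -> inner S v (next v c) && (c != next v c).
  move=> vS; rewrite /next; case: pickP => [//|/= no].
  by have [c' gc nc] := nextP v c vS; have := no c'; rewrite gc nc.
(* A state of the walk is the current vertex with the last color used; the initial color [c0] is
   arbitrary. *)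
pose step x := let c := next x.1 x.2 in (s c x.1, c).
pose z i := iter i step (v0, c0).
have zS i : (z i).1 \in S.
  by elim: i => //= i /nextS-/(_ (z i).2)/andP[/and3P[]].
have zcon i : connect e v0 (z i).1.
  elim: i => //= i IH; apply: connect_trans IH (connect1 _) => /=.
  by have /andP[/and3P[]] := nextS _ (z i).2 (zS i).
(* The start is arbitrary, so that the statement applies to the segment from [z i] to [z j]; the
   path condition makes its color word reduced. *)
have walk m x : x.1 \in S ->
    let p := map snd (traject step (step x) m) in
    (iter m step x).1 = foldl (fun v c => s c v) x.1 p /\ path (fun a b => a != b) x.2 p.
  elim: m x => [//|m IH] x xS.
  have /andP[/and3P[_ sS _] ne] := nextS _ x.2 xS.
  have [E P] := IH (step x) sS; split; first by rewrite iterSr E.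
  by rewrite /= ne P.
have noinj : ~~ injectiveb (fun i : 'I_k.+1 => (z i).1).
  apply/negP => /injectiveP inj.
  have /subset_leq_card : codom (fun i : 'I_k.+1 => (z i).1) \subset connect e v0.
    by apply/fintype.subsetP => v /codomP[i ->]; apply: zcon.
  by rewrite (card_codom inj) card_ord leqNgt ltnS small.
have [i [j [ltij ltj E]]] : exists i j, [/\ (i < j)%N, (j < k.+1)%N & (z i).1 = (z j).1].
  case/injectivePn: noinj => i [j ne E].
  have [lt|lt|/val_inj eq] := ltngtP i j; last by rewrite eq eqxx in ne.
    by exists i, j.
  by exists j, i.
have [E1 P1] := walk (j - i)%N (z i) (zS i).
have := @free (z i).1 [seq x.2 | x <- traject step (step (z i)) (j - i)]
  (fintype.subsetP sSA _ (zS i)) (path_sorted P1).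
rewrite -E1 size_map size_traject -iterD subnK ?(ltnW ltij)// -/(z j) -E eqxx.
by have -> : (0 < j - i <= k)%N; [lia | move=> /(_ isT)].
Qed.

(* Each edge is counted twice, once from each endpoint. *)
Lemma forest_bound :
  (#|[set x : V * C | inner A x.1 x.2]%SET| <= 2 * #|A|)%N.
Proof.
suff H m (S : {set V}) : S \subset A -> #|S| = m ->
    (#|[set x : V * C | inner S x.1 x.2]%SET| <= 2 * m)%N by exact: H.
elim: m S => [|m IH] S sSA Sm.
  move/eqP: Sm; rewrite cards_eq0 => /eqP S0; rewrite leqn0 cards_eq0.
  by apply/eqP/setP => x; rewrite !inE /inner_arc S0 inE.
have [|v vS leaf] := exists_leaf sSA; first by rewrite -cards_eq0 Sm.
have {}IH : (#|[set x : V * C | inner (S :\ v)%SET x.1 x.2]%SET| <= 2 * m)%N.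
  apply: IH; first exact: fintype.subset_trans (subD1set _ _) sSA.
  by have := cardsD1 v S; rewrite vS Sm => -[].
set L := [set c | inner S v c]%SET in leaf.
(* Deleting the leaf [v] loses the arcs out of [v], in [D1], and the arcs into [v], in [D2]: at most
   one of each. *)
pose D1 := [set (v, c) | c in L]%SET; pose D2 := [set (s c v, c) | c in L]%SET.
have sub : [set x : V * C | inner S x.1 x.2]%SET \subset
    ([set x : V * C | inner (S :\ v) x.1 x.2] :|: (D1 :|: D2))%SET.
  apply/fintype.subsetP => -[u c]; rewrite inE /= => /and3P[uS sS euc].
  rewrite !finset.in_setU; have [cu|nu] := eqVneq (s c u) v.
    apply/orP; right; apply/orP; right; apply/imsetP; exists c; last by rewrite -cu s_invol.
    by rewrite inE /inner_arc -cu s_invol uS sS e_sym.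
  have [eu|nv] := eqVneq u v.
    apply/orP; right; apply/orP; left; apply/imsetP; exists c; rewrite ?eu//.
    by rewrite inE /inner_arc -eu uS sS.
  by rewrite inE /inner_arc !inE /= nu nv uS sS euc.
have := leq_imset_card (fun c => (v, c)) L; rewrite -/D1 => l1.
have := leq_imset_card (fun c => (s c v, c)) L; rewrite -/D2 => l2.
have := subset_leq_card sub.
have := (leq_card_setU [set x : V * C | inner (S :\ v)%SET x.1 x.2]%SET (D1 :|: D2)%SET).1.
have := (leq_card_setU D1 D2).1.
lia.
Qed.

End FreeInvolutions.

(** * Color flips on a ball of the regular tree *)

Section TreeBall.

Variable C : eqType.

(** A vertex of the tree is the color word of its path to the root, the head being the edge to its
    parent. *)
Definition ball (k : nat) : pred (seq C) := fun w => reduced w && (size w <= k)%N.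

(** Crosses the edge of color [c], up to the parent or down to a child. A word whose edge of color
    [c] leaves the ball stays fixed, which keeps the map an involution. *)
Definition flip k (c : C) (w : seq C) : seq C :=
  if w is c' :: w' then
    if c == c' then w' else if (size w < k)%N then c :: w else w
  else if (0 < k)%N then [:: c] else [::].

Lemma flip_ball k c w : ball k w -> ball k (flip k c w).
Proof.
rewrite /ball /flip; case: w => [|c' w] /andP[r l]; first by case: ifP.
case: eqP => [_|/eqP ne]; first by rewrite /reduced (path_sorted r) ltnW.
by case: ifP => [l'|_]; rewrite ?r ?l// /reduced /= ne; move: r; rewrite /reduced /= => ->.
Qed.

(** After a step up, reducedness makes the new head differ from [c] and the length is below [k], so
    the next flip pushes [c] back. *)
Lemma flipK k c w : ball k w -> flip k c (flip k c w) = w.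
Proof.
rewrite /ball /flip; case: w => [|c' w] /andP[r l].
  by case: ifP => //= k0; rewrite ?eqxx ?k0.
case: eqP => [->|/eqP ne].
  case: w r l => [|c2 w] r l /=; first by rewrite l.
  by move: r; rewrite /reduced /= => /andP[/negPf-> _]; rewrite (_ : _ < k)%N.
by case: ifP => l'; rewrite ?eqxx// (negPf ne) l'.
Qed.

(** In a reduced word no letter cancels the one before it, so every flip moves away from the
    root. *)
Lemma foldr_flip k p : reduced p -> (size p <= k)%N -> foldr (flip k) [::] p = p.
Proof.
elim: p => //= c p IH r l; rewrite (IH (path_sorted r) (ltnW l)).
case: p r l {IH} => [|c' p] /= r l; first by rewrite l.
by move: r; rewrite /reduced /= => /andP[/negPf-> _]; rewrite l.
Qed.

End TreeBall.

(** * The property and its isolated vertices *)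

Definition isolated n (G : sgraph n) : {set 'I_n} :=
  [set u | degree G u == 0%N]%SET.

Definition half_isolated (d : nat) : graphs := fun x =>
  bounded d (tagged x) /\ (tag x <= 2 * #|isolated (tagged x)|)%N.

Lemma adjC n (G : sgraph n) : symmetric (adj G).
Proof. by move=> u v; rewrite /adj finset.setUC. Qed.

Lemma isolatedP n (G : sgraph n) u : reflect (forall v, ~~ adj G u v) (u \in isolated G).
Proof.
rewrite inE; apply: (iffP eqP) => [/card0_eq H v|H]; first by exact: (negbT (H v)).
by apply: eq_card0 => v; apply/negbTE/H.
Qed.

Lemma half_isolated_property d : graph_property (half_isolated d).
Proof.
move=> n G H [f [bf fadj]] [/= bd iso].
have deg u : degree H (f u) = degree G u.
  rewrite /degree -[RHS](fintype.card_image (bij_inj bf)); apply: eq_card => w.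
  have [g fK gK] := bf; rewrite -(gK w) fintype.mem_image; last exact: bij_inj.
  exact: fadj.
have [g fK gK] := bf.
split=> [u|/=]; first by rewrite -(gK u) deg.
suff -> : #|isolated H| = #|isolated G| by [].
rewrite -[RHS](card_imset _ (bij_inj bf)); apply: eq_card => w.
by rewrite -(gK w) (mem_imset _ _ (bij_inj bf)) !inE deg.
Qed.

Lemma edges_set0 n : [forall e in (finset.set0 : {set {set 'I_n}}), #|e| == 2%N].
Proof. by apply/forall_inP => e; rewrite inE. Qed.

Definition edgeless n : sgraph n := SGraph (edges_set0 n).

Lemma isolated_edgeless n : isolated (edgeless n) = [set: _]%SET.
Proof. by apply/setP => u; rewrite finset.in_setT; apply/isolatedP => v; rewrite /adj inE. Qed.

Lemma half_isolated_infinite d : infinite_set (half_isolated d).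
Proof.
move=> fin.
(* The edgeless graphs realize every number of vertices, so the image under [tag] is all of
   [nat]. *)
suff : finite_set (@setT nat) by apply: infinite_nat.
apply: sub_finite_set (finite_image (fun x => tag x) fin) => n _.
exists (Tagged sgraph (edgeless n)) => //; split=> [u|] /=.
  have : u \in isolated (edgeless n) by rewrite isolated_edgeless finset.in_setT.
  by rewrite inE => /eqP->.
by rewrite isolated_edgeless cardsT card_ord; lia.
Qed.

Lemma edge_card n (G : sgraph n) e : e \in edges G -> #|e| = 2%N.
Proof. by move=> eG; have /forall_inP/(_ _ eG)/eqP := edges_card2 G. Qed.

Lemma leq_card_cover2 n (G : sgraph n) (E : {set {set 'I_n}}) :
  E \subset edges G -> (#|finset.cover E| <= 2 * #|E|)%N.
Proof.
move=> sEG; apply: leq_trans (leq_card_cover E) _.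
rewrite (eq_bigr (fun=> 2%N)) ?sum_nat_const 1?mulnC// => e eE.
exact: edge_card (fintype.subsetP sEG _ eE).
Qed.

(** * Edit distance and isolated vertices *)

Lemma connected_edit_dist n (G H : sgraph n) :
  (2 <= n)%N -> connected H -> (#|isolated G| <= 2 * edit_dist G H)%N.
Proof.
move=> n2 conH.
have nb u : exists v, adj H u v.
  (* A second vertex exists by [2 <= n], and a walk to it begins with an edge at [u]. *)
  have [v ne] : exists v, v != u.
    have /card_gt0P[v] : (0 < #|[set~ u]%SET|)%N by rewrite cardsC1 card_ord; lia.
    by rewrite !inE; exists v.
  have /connectP[[|w p] /=] := conH u v; first by move=> _ eq; rewrite eq eqxx in ne.
  by move=> /andP[uw _] _; exists w.
have sub : isolated G \subset finset.cover (edges H :\: edges G)%SET.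
  apply/fintype.subsetP => u /isolatedP uiso; have [v uv] := nb u.
  apply/bigcupP; exists [set u; v]%SET; last by rewrite !inE eqxx.
  by rewrite inE; apply/andP; split; [exact: uiso|exact: uv].
apply: leq_trans (subset_leq_card sub) _.
apply: leq_trans (leq_card_cover2 (finset.subsetDl _ _)) _.
by rewrite leq_mul2l /= subset_leq_card// finset.subsetUr.
Qed.

Lemma edges_isolate n (G : sgraph n) (J : {set 'I_n}) :
  [forall e in [set e in edges G | [disjoint e & J]]%SET, #|e| == 2%N].
Proof. by apply/forall_inP => e; rewrite inE => /andP[/edge_card->]. Qed.

Definition isolate n (G : sgraph n) (J : {set 'I_n}) : sgraph n :=
  SGraph (edges_isolate G J).

Lemma adj_isolate n (G : sgraph n) J u v :
  adj (isolate G J) u v = [&& adj G u v, u \notin J & v \notin J].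
Proof.
by rewrite /adj inE finset.disjoints_subset finset.subUset !finset.sub1set !inE.
Qed.

Lemma degree_isolate n (G : sgraph n) J u : (degree (isolate G J) u <= degree G u)%N.
Proof.
apply/subset_leq_card/fintype.subsetP => v.
by rewrite -[v \in _]/(adj _ u v) adj_isolate => /and3P[].
Qed.

(** Every deleted edge joins some [u] in [J] to one of its at most [d] neighbors. *)
Lemma edit_dist_isolate d n (G : sgraph n) J :
  bounded d G -> (edit_dist G (isolate G J) <= d * #|J|)%N.
Proof.
move=> bd; rewrite /edit_dist /=.
have sub : (edges G :\: [set e in edges G | [disjoint e & J]] :|:
            [set e in edges G | [disjoint e & J]] :\: edges G)%SET \subset
   (\bigcup_(u in J) [set [set u; v] | v in adj G u])%SET.
  apply/fintype.subsetP => e; rewrite !inE.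
  have [eG|] := boolP (e \in edges G); last by [].
  rewrite /= orbF andbT => /pred0Pn[u /andP[/= ue uJ]].
  have /cards2P[x [y [ne eE]]] : #|e| == 2%N by rewrite (edge_card eG).
  apply/finset.bigcupP; exists u => //; apply/imsetP; move: ue eG; rewrite eE !inE.
  case/orP=> /eqP-> xy; first by exists y.
  by exists x; [rewrite -[_ \in _]/(adj G y x) adjC | exact: finset.setUC].
apply: leq_trans (subset_leq_card sub) _.
have -> : (d * #|J| = \sum_(u in J) d)%N by rewrite sum_nat_const mulnC.
apply: (big_ind2 (fun (X : {set {set 'I_n}}) m => (#|X| <= m)%N)).
- by rewrite cards0.
- move=> X a Y b Xa Yb; apply: leq_trans (leq_card_setU X Y).1 _.
  exact: leq_add.
- by move=> u _; apply: leq_trans (leq_imset_card _ _) (bd u).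
Qed.

(* If n is odd, rounding costs 1/(2n); as at least one vertex must still be
   isolated, this is absorbed by halving eps. *)
Lemma far_isolated (R : realType) d (eps : R) n (G : sgraph n) :
  0 < eps -> bounded d G -> far d (half_isolated d) eps G ->
  #|isolated G|%:R / n%:R <= 1 / 2 - eps / 2 :> R.
Proof.
move=> eps0 bd farG.
(* [j] is the number of isolated vertices still missing; truncated subtraction makes it 0 when there
   are enough. *)
pose i := #|isolated G|; pose j := (uphalf n - i)%N.
have iC : (#|~: isolated G|%SET = n - i)%N.
  by have := cardsC (isolated G); rewrite card_ord /i; lia.
have [J sJ cJ] : exists2 J : {set 'I_n}, J \subset (~: isolated G)%SET & #|J| = j.
  have /card_gt0P[J] : (0 < #|[set J : {set 'I_n} | J \subset ~: isolated G & #|J| == j]%SET|)%N.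
    by rewrite cards_draws iC bin_gt0 /j uphalf_half; lia.
  by rewrite inE => /andP[? /eqP]; exists J.
have bdI : bounded d (isolate G J) by move=> u; apply: leq_trans (degree_isolate G J u) (bd u).
have sI : (J :|: isolated G)%SET \subset isolated (isolate G J).
  apply/fintype.subsetP => u; rewrite finset.in_setU => uJ; apply/isolatedP => v.
  rewrite adj_isolate; case/orP: uJ => [->|/isolatedP/(_ v)/negPf->//].
  by rewrite andbF.
have half : (n <= 2 * #|isolated (isolate G J)|)%N.
  have := subset_leq_card sI; rewrite cardsU.
  have -> : (J :&: isolated G)%SET = finset.set0.
    by apply/eqP; rewrite finset.setI_eq0 finset.disjoints_subset.
  rewrite cards0 cJ /j /i uphalf_half; lia.
have /(lt_le_trans (farG _ (conj bdI half))) : (edit_dist G (isolate G J))%:R <= (d * j)%:R :> R.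
  by rewrite ler_nat -cJ edit_dist_isolate.
have [->|d0] := posnP d; first by rewrite mul0n mulr0 mul0r ltxx.
rewrite natrM -mulrA mulrCA ltr_pM2l ?ltr0n// => epsj.
have j0 : (0 < j)%N by rewrite -(ltr_nat R); apply: le_lt_trans epsj; rewrite mulr_ge0// ltW.
have n0 : (0 < n)%N by move: j0; rewrite /j uphalf_half; lia.
(* As [j] is positive, [i] is below [uphalf n], so [i + uphalf n <= n] even for odd [n]. *)
have : (2 * i + j <= n)%N by move: j0; rewrite /j uphalf_half; lia.
rewrite -(ler_nat R) natrD natrM => ij.
rewrite -/i ler_pdivrMr ?ltr0n//; lra.
Qed.

(** * The sampling tester *)

Fixpoint sampler n d (i : 'I_d) (accept : pred nat) (m acc : nat) : algo n.+1 d :=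
  if m is m'.+1 then
    Random (fun u : 'I_n.+1 =>
      Query u i (fun a => sampler n i accept m' (acc + (a == None))))
  else Output _ _ (accept acc).

Lemma num_queries_sampler n d (i : 'I_d) accept m acc (L : adjlist n.+1) :
  (num_queries L (sampler n i accept m acc) <= m)%N.
Proof.
elim: m acc => //= m IH acc.
by apply/bigmax_leqP => u _; apply: IH.
Qed.

(** In whatever order neighbors are listed, a nonempty list has an entry at position 0. *)
Lemma answer_isolated n d (i : 'I_d) (L : adjlist n) G u : i = 0%N :> nat ->
  represents L G -> (answer L u i == None) = (u \in isolated G).
Proof.
move=> i0 /(_ u)[_ LG]; rewrite /answer i0.
apply/eqP/isolatedP => [none v|iso].
  apply/negP => uv; have : v \in L u by rewrite LG.
  by case: (L u) none.
case LE : (L u) => [//|v s]; have := iso v.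
by rewrite -[adj _ _ _]/(v \in adj G u) -LG LE mem_head.
Qed.

(* Chebyshev's inequality: the bracket is the second moment about t of the final
   count, computed along the run of the sampler. *)
Lemma prob_sampler (R : realType) n d (i : 'I_d) accept m acc b (t D : R)
    (L : adjlist n.+1) G (p := #|isolated G|%:R / n.+1%:R : R) :
  i = 0%N :> nat -> represents L G -> 0 < D ->
  (forall x : nat, 1 - (x%:R - t) ^+ 2 / D <= (accept x == b)%:R) ->
  1 - ((acc%:R + m%:R * p - t) ^+ 2 + m%:R * (p * (1 - p))) / D <=
    prob_output R L (sampler n i accept m acc) b.
Proof.
move=> i0 LG D0 acceptP; elim: m acc => [|m IH] acc /=.
  by rewrite !mul0r !addr0.
pose f (x : nat) := 1 - ((x%:R + m%:R * p - t) ^+ 2 + m%:R * (p * (1 - p))) / D.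
apply: (@le_trans _ _ ((\sum_(u < n.+1) f (acc + (u \in isolated G))%N) / n.+1%:R)); last first.
  rewrite ler_pM2r ?invr_gt0 ?ltr0n//; apply: ler_sum => u _.
  by rewrite (answer_isolated u i0 LG); apply: IH.
have n0 : n.+1%:R != 0 :> R by rewrite pnatr_eq0.
have -> : \sum_(u < n.+1) f (acc + (u \in isolated G))%N =
    #|isolated G|%:R * f acc.+1 + (n.+1%:R - #|isolated G|%:R) * f acc.
  rewrite (bigID (mem (isolated G))) /=; congr (_ + _).
    rewrite (eq_bigr (fun=> f acc.+1)) => [|u ->]; last by rewrite addn1.
    by rewrite sumr_const mulr_natl.
  rewrite (eq_bigr (fun=> f acc)) => [|u /negPf->]; last by rewrite addn0.
  have -> : n.+1%:R = #|isolated G|%:R + #|[predC isolated G]|%:R :> R.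
    by rewrite -natrD cardC card_ord.
  by rewrite addrAC subrr add0r sumr_const mulr_natl.
have -> : #|isolated G|%:R = p * n.+1%:R by rewrite divfK.
(* The bound is preserved with equality: a Bernoulli sample of mean [p] adds [p] to the mean and
   [p * (1 - p)] to the variance. *)
rewrite le_eqVlt; apply/orP; left; apply/eqP; rewrite /f -!natr1.
field.
by rewrite natr1 n0 gt_eqF.
Qed.

Lemma half_isolated_testable (R : realType) d : (0 < d)%N ->
  testable d (half_isolated d) (fun eps : R => 13 * (d%:R / eps ^+ 2)).
Proof.
move=> d0; pose i0 := Ordinal d0.
(* More than 12 / eps^2 samples bring the failure bound 4 / (m eps^2) below 1/3; rounding up adds at
   most 1, which is at most 1 / eps^2, whence 13. *)
have [m mP] : exists m : R -> nat, forall eps, 0 < eps -> eps <= 1 ->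
    12 < (m eps)%:R * eps ^+ 2 <= 13.
  exists (fun eps => (Num.truncn (12 / eps ^+ 2)).+1) => eps eps0 eps1.
  have e2 : 0 < eps ^+ 2 by rewrite exprn_gt0.
  have /andP[lo hi] := truncn_itv (divr_ge0 (ler0n R 12) (ltW e2)).
  rewrite -ltr_pdivrMr// hi /= -natr1.
  by rewrite ler_pdivlMr// in lo; nra.
(* The threshold lies midway between 1/2, for members, and 1/2 - eps/2, for far graphs. *)
pose accept (eps : R) (x : nat) := (1 / 2 - eps / 4) * (m eps)%:R <= x%:R.
(* Sampling requires a vertex. The empty graph is a member, and for [eps > 1] no graph is far, so
   accepting is correct in both cases. *)
exists (fun eps n => if n is n'.+1 then
    if eps <= 1 then sampler n' i0 (accept eps) (m eps) 0 else Output _ _ true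
  else Output _ _ true).
move=> eps n G L eps0 bd LG.
have q0 : 0 <= 13 * (d%:R / eps ^+ 2) by rewrite mulr_ge0 ?divr_ge0// ltW// exprn_gt0.
case: n G L bd LG => [|n] G L bd LG /=.
  split=> [//|_|/(_ G)]; first by lra.
  by move=> /(_ (conj bd (leq0n _))); rewrite mulr0 /edit_dist finset.setDv finset.setU0 cards0 ltxx.
have [eps1|eps1] := leP eps 1; last first.
  split=> [//|_|/(far_isolated eps0 bd) iso]; first by rewrite /=; lra.
  have /le_trans/(_ iso) : 0 <= #|isolated G|%:R / n.+1%:R :> R by rewrite divr_ge0.
  lra.
have e2 : 0 < eps ^+ 2 by rewrite exprn_gt0.
have /andP[Mlo Mhi] := mP _ eps0 eps1.
set M : R := (m eps)%:R in Mlo Mhi.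
have M0 : 0 < M by rewrite -(pmulr_lgt0 _ e2); apply: lt_trans Mlo.
set p : R := #|isolated G|%:R / n.+1%:R.
have p0 : 0 <= p by rewrite divr_ge0.
have p1 : p <= 1.
  rewrite ler_pdivrMr ?ltr0n// mul1r ler_nat.
  by have := max_card (mem (isolated G)); rewrite card_ord.
pose D : R := (eps * M / 4) ^+ 2.
have D0 : 0 < D by rewrite exprn_gt0// divr_gt0// mulr_gt0.
have main b : (forall x : nat, 1 - (x%:R - M * p) ^+ 2 / D <= (accept eps x == b)%:R) ->
    2 / 3 <= prob_output R L (sampler n i0 (accept eps) (m eps) 0) b.
  move=> H; have := prob_sampler (i := i0) (m eps) 0 (erefl _) LG D0 H.
  apply: le_trans.
  rewrite -/p -/M add0r subrr expr0n add0r.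
  suff : M * (p * (1 - p)) / D <= 1 / 3 by lra.
  rewrite ler_pdivrMr// /D.
  have : p * (1 - p) <= 1 / 4 by have := sqr_ge0 (p - 1 / 2); lra.
  rewrite -(ler_pM2l M0); have : M * 12 < M * (M * eps ^+ 2) by rewrite ltr_pM2l.
  lra.
(* A wrong verdict forces a deviation whose square is at least [D], so the left side is then at most
   0. *)
have dev (x : nat) b : (accept eps x != b -> (eps * M / 4) <= `|x%:R - M * p|) ->
    1 - (x%:R - M * p) ^+ 2 / D <= (accept eps x == b)%:R.
  have [_ _|_ /(_ isT) h] := eqVneq (accept eps x) b.
    by rewrite lerBlDr lerDl divr_ge0 ?sqr_ge0// ltW.
  rewrite subr_le0 ler_pdivlMr// mul1r /D -(real_normK (num_real (x%:R - _))).
  by rewrite ler_sqr// ?nnegrE ?normr_ge0// ltW// divr_gt0// mulr_gt0.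
split.
- rewrite (le_trans (y := M))//; first by rewrite ler_nat num_queries_sampler.
  rewrite mulrA ler_pdivlMr//; apply: le_trans Mhi _.
  by rewrite ler_peMr// ler1n.
- move=> [_ /= iso]; apply: main => x; apply: dev.
  have {}iso : 1 / 2 <= p.
    have : n.+1%:R <= (2 * #|isolated G|)%:R :> R by rewrite ler_nat.
    rewrite /p natrM ler_pdivlMr ?ltr0n//; lra.
  rewrite eqb_id /accept -ltNge -/M => lt; rewrite ler_normr; apply/orP; right; nra.
- move=> farG; have := far_isolated eps0 bd farG; rewrite -/p => iso.
  apply: main => x; apply: dev.
  rewrite eqbF_neg negbK /accept -/M => lt; rewrite ler_normr; apply/orP; left; nra.
Qed.

(** * Free action on the permutations of the ball *)

Section BallPerm.

Variables (C : finType) (k : nat).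

Definition ball_word := {w : {bseq k of C} | reduced (w : seq C)}.

Lemma ball_wordP (w : ball_word) : ball k (val (val w)).
Proof. by rewrite /ball (valP w) size_bseq. Qed.

Lemma flip_size c (w : ball_word) : (size (flip k c (val (val w))) <= k)%N.
Proof. by have /andP[] := flip_ball c (ball_wordP w). Qed.

Lemma flip_reduced c (w : ball_word) : reduced (Bseq (flip_size c w) : seq C).
Proof. by have /andP[] := flip_ball c (ball_wordP w). Qed.

Definition flip_word c (w : ball_word) : ball_word :=
  exist _ (Bseq (flip_size c w)) (flip_reduced c w).

Lemma flip_wordK c : involutive (flip_word c).
Proof. by move=> w; do 2 apply: val_inj; exact: flipK (ball_wordP w). Qed.

Definition flip_perm c : {perm ball_word} := perm (inv_inj (flip_wordK c)).

Definition root_word : ball_word := exist _ [bseq] isT.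

Lemma val_foldr_flip p :
  val (val (foldr flip_word root_word p)) = foldr (flip k) [::] p.
Proof. by elim: p => //= c p <-. Qed.

Lemma flip_permK c (g : {perm ball_word}) : (flip_perm c * (flip_perm c * g))%g = g.
Proof. by apply/permP => w; rewrite !permM !permE flip_wordK. Qed.

(** Permutations compose from left to right, so each left multiplication by a flip acts on the word
    before [g] does. *)
Lemma foldl_flip_perm (g : {perm ball_word}) p w :
  foldl (fun h c => flip_perm c * h)%g g p w = g (foldr flip_word w p).
Proof. by elim: p g => //= c p IH g; rewrite IH permM permE. Qed.

(** Evaluation at the root and injectivity of [g] reduce a fixed point to [p] fixing the root, but
    [p] carries the root to the nonempty word [p]. *)
Lemma flip_perm_free (g : {perm ball_word}) p : reduced p -> (0 < size p <= k)%N ->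
  foldl (fun h c => flip_perm c * h)%g g p != g.
Proof.
move=> pred /andP[p0 pk]; apply/eqP => /permP/(_ root_word).
rewrite foldl_flip_perm => /perm_inj/(congr1 (val \o val)) /=.
by rewrite val_foldr_flip (foldr_flip pred pk) => p1; rewrite p1 in p0.
Qed.

End BallPerm.

Lemma free_involutions (C : finType) k :
  exists n (s : C -> 'I_n -> 'I_n) (A : {set 'I_n}),
  [/\ (0 < n)%N, n = (2 * #|A|)%N, forall c, involutive (s c),
      forall u c, u \notin A -> s c u = u
    & forall u p, u \in A -> reduced p -> (0 < size p <= k)%N ->
        foldl (fun v c => s c v) u p != u].
Proof.
(* The copy of [V] marked [true] carries the Cayley action; the copy marked [false] is the padding
   by fixed points. *)
pose V := {perm ball_word C k}; pose W : finType := (V * bool)%type.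
pose act c (x : W) : W := if x.2 then ((flip_perm k c * x.1)%g, true) else x.
have actK c : involutive (act c).
  by case=> g []; rewrite /act //= flip_permK.
pose A := [set u : 'I_#|W| | (enum_val u).2]%SET.
have cA : #|A| = #|V|.
  rewrite -(card_imset A enum_val_inj).
  rewrite -(card_imset (mem V) (f := fun g => (g, true) : W)); last by move=> g h [].
  apply: eq_card => -[g b]; apply/imsetP/imsetP => [[u]|[h _ [-> ->]]].
    by rewrite inE => + E; rewrite -E /= => ->; exists g.
  by exists (enum_rank ((h, true) : W)); rewrite ?inE enum_rankK.
exists #|W|, (fun c u => enum_rank (act c (enum_val u))), A; split.
- by apply/card_gt0P; exists (1%g, true).
- by rewrite cA card_prod card_bool mulnC.
- by move=> c u; rewrite enum_rankK actK enum_valK.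
- by move=> u c; rewrite inE /act => /negPf->; rewrite enum_valK.
- move=> u p; rewrite inE => uA pred pk.
  have E q g : foldl (fun v c => enum_rank (act c (enum_val v))) (enum_rank ((g, true) : W)) q
      = enum_rank ((foldl (fun h c => flip_perm k c * h)%g g q, true) : W).
    by elim: q g => //= c q IH g; rewrite enum_rankK /act /= IH.
  rewrite -(enum_valK u); move: uA; case: (enum_val u) => g b /= ->.
  rewrite E (inj_eq enum_rank_inj) xpair_eqE andbT; exact: flip_perm_free.
Qed.

(** * The graph of a family of free involutions *)

Section InvolutionGraph.

Variables (n k : nat) (C : finType) (s : C -> 'I_n -> 'I_n) (A : {set 'I_n}).
Hypothesis k0 : (0 < k)%N.
Hypothesis s_invol : forall c, involutive (s c).
Hypothesis s_fix : forall u c, u \notin A -> s c u = u.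
Hypothesis s_free : forall u p, u \in A -> reduced p -> (0 < size p <= k)%N ->
  foldl (fun v c => s c v) u p != u.

Lemma s_neq u c : u \in A -> s c u != u.
Proof. by move=> uA; apply: (s_free (p := [:: c])). Qed.

Lemma s_stable u c : u \in A -> s c u \in A.
Proof.
move=> uA; apply/negPn/negP => /(@s_fix _ c); rewrite s_invol => /esym/eqP.
by apply/negP/s_neq.
Qed.

(** Restricting [u] to [A] excludes the singletons that fixed points would give. *)
Definition involution_edges : {set {set 'I_n}} :=
  [set [set u; s c u] | u in A, c in C]%SET.

Lemma involution_edges_card2 : [forall e in involution_edges, #|e| == 2%N].
Proof.
by apply/forall_inP => e /imset2P[u c uA _ ->]; rewrite cards2 (eq_sym u) s_neq.
Qed.

Definition involution_graph : sgraph n := SGraph involution_edges_card2.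

Lemma adj_involution_graph u v : adj involution_graph u v ->
  u \in A /\ exists c, v = s c u.
Proof.
rewrite /adj => /imset2P[w c wA _ E].
have uv : u != v.
  have : #|[set u; v]%SET| = 2%N by rewrite E cards2 (eq_sym w) s_neq.
  by rewrite cards2; case: eqP.
have : u \in [set w; s c w]%SET by rewrite -E !inE eqxx.
have : v \in [set w; s c w]%SET by rewrite -E !inE eqxx orbT.
rewrite !inE => /orP[]/eqP vE /orP[]/eqP uE; rewrite ?vE ?uE in uv *.
- by rewrite eqxx in uv.
- by split; [exact: s_stable | exists c; rewrite s_invol].
- by split=> //; exists c.
- by rewrite eqxx in uv.
Qed.

Lemma bounded_involution_graph d : (#|C| <= d)%N -> bounded d involution_graph.
Proof.
move=> Cd u; apply: leq_trans Cd.
apply: leq_trans (leq_imset_card (fun c => s c u) C).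
apply/subset_leq_card/fintype.subsetP => v /adj_involution_graph[_ [c ->]].
exact: imset_f.
Qed.

Lemma half_isolated_involution_graph d : (#|C| <= d)%N -> n = (2 * #|A|)%N ->
  slice (half_isolated d) involution_graph.
Proof.
move=> Cd nA; split; first exact: bounded_involution_graph.
have sub : (~: A)%SET \subset isolated involution_graph.
  apply/fintype.subsetP => u; rewrite inE => uA; apply/isolatedP => v.
  by apply/negP => /adj_involution_graph[]; rewrite (negPf uA).
have cA : #|~: A|%SET = #|A|.
  by apply: (@addnI #|A|); rewrite cardsC card_ord addnn -mul2n.
by rewrite /= [X in (X <= _)%N]nA -cA leq_mul2l subset_leq_card.
Qed.

(** Of the [#|C| * #|A|] arcs, at most [2 * #|A|] survive by [forest_bound]. The others start at an
    end of a removed edge, and each end starts at most [#|C|] arcs. *)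
Lemma involution_graph_removal (H : sgraph n) :
  edges H \subset edges involution_graph ->
  (forall u, #|component H u| <= k)%N ->
  ((#|C| - 2) * #|A| <= 2 * #|C| * #|edges involution_graph :\: edges H|%SET)%N.
Proof.
move=> sHG comp.
have forest : (#|[set x : 'I_n * C | inner_arc s (adj H) A x.1 x.2]%SET| <= 2 * #|A|)%N.
  apply: (forest_bound (k := k)) => // [|u]; first exact: adjC.
  by apply: leq_trans (comp u); rewrite /component cardsE.
set R := (_ :\: _)%SET.
have sub : (finset.setX A [set: C] \subset
   [set x : 'I_n * C | inner_arc s (adj H) A x.1 x.2] :|: finset.setX (finset.cover R) [set: C])%SET.
  apply/fintype.subsetP => -[u c]; rewrite !inE /= andbT => uA.
  rewrite /inner_arc /= uA s_stable//= andbT; have [//|nadj] := boolP (adj H u (s c u)).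
  apply/finset.bigcupP; exists [set u; s c u]%SET; last by rewrite !inE eqxx.
  by rewrite inE nadj /=; apply/imset2P; exists u c.
have := leq_trans (subset_leq_card sub) (leq_card_setU _ _).1.
rewrite !cardsX !cardsT => bound.
rewrite mulnBl leq_subLR mulnC; apply: leq_trans bound _; apply: leq_add => //.
rewrite mulnAC leq_mul2r; apply/orP; right.
exact: (@leq_card_cover2 _ involution_graph R (finset.subsetDl _ _)).
Qed.

End InvolutionGraph.

(** * Failure of hyperfiniteness *)

Lemma half_isolated_not_hyperfinite (R : realType) d : (3 <= d)%N ->
  ~ hyperfinite R d (half_isolated d).
Proof.
move=> d3 [rho hyp].
have d0 : 0 < d%:R :> R by rewrite ltr0n; lia.
(* With three colors and [n = 2 * #|A|], at least n/12 edges must go, while this [eps] allows only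
   n/13. *)
pose eps : R := (13 * d%:R)^-1.
have [|k0 {}hyp] := hyp eps; first by rewrite invr_gt0 mulr_gt0.
have [n [s [A [n0 nA invol fixed free]]]] := free_involutions 'I_3 (rho eps).
have C3 : (#|'I_3| <= d)%N by rewrite card_ord.
have [H [sHG few comp]] :=
  hyp n _ (half_isolated_involution_graph k0 invol fixed free C3 nA).
have := involution_graph_removal invol fixed sHG comp.
rewrite card_ord mul1n => many.
have : eps * d%:R * n%:R = n%:R / 13.
  by rewrite /eps invfM -mulrA mulrA; field; rewrite gt_eqF.
move=> E; rewrite E ler_pdivlMr// in few.
move: few; rewrite -natrM ler_nat; lia.
Qed.

Theorem theorem1p4 (R : realType) :
  exists (C c : R) (n0 : nat), 0 < C /\ 0 < c /\
  forall d : nat, (3 <= d)%N ->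
  exists Pi : graphs,
    [/\ graph_property Pi,
        infinite_set Pi
      & forall n (G : sgraph n), slice Pi G -> bounded d G] /\
    [/\ testable d Pi (fun eps : R => C * (d%:R / eps ^+ 2)),
        ~ hyperfinite R d Pi
      & forall n (G H : sgraph n), (n0 <= n)%N -> slice Pi G -> connected H ->
          c * n%:R <= (edit_dist G H)%:R].
Proof.
(* The constant 1/4 comes from n/2 isolated vertices and two of them per inserted edge. The bound 2
   excludes the single vertex, which is connected without edges. *)
exists 13, (1 / 4), 2%N; split=> //; split=> [|d d3]; first by rewrite divr_gt0.
exists (half_isolated d); split; split.
- exact: half_isolated_property.
- exact: half_isolated_infinite.
- by move=> n G [].
- by apply: half_isolated_testable; apply: leq_trans d3.
- exact: half_isolated_not_hyperfinite.
- move=> n G H n2 [_ /= iso] conH.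
  have := leq_trans iso (leq_mul (leqnn 2) (connected_edit_dist G n2 conH)).
  by rewrite -(ler_nat R) !natrM; lra.
Qed.
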